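(* Let $\delta\in(0,1)$, let $X\subset\mathbb{R}_+$ be a Borel set with $0\in X$, and let $x_0>0$. Let $\bar p$ be the stationary decision rule with $\bar p(y)=\frac{1-\delta}{2-\delta}$ for every best-so-far alternative $y$ (i.e. it stops with probability $\frac{1-\delta}{2-\delta}$ after every history). Then: (a) $R_{\bar p}(x_0,\mathcal F_X)\ge 1/4$; (b) if $\sup X=\infty$, then $\bar p$ is dynamically robust for $(x_0,\mathcal F_X)$.
   Context: Sequential search model. Fix a discount factor $\delta\in(0,1)$, a Borel set $X\subset\mathbb{R}_+$ with $0\in X$, and an outside option $x_0>0$. Let $\mathcal F_X$ be the set of all Borel probability distributions on $X$ with finite mean (''environments''); a set of feasible environments is any $\mathcal F\subset\mathcal F_X$. A history is $h_t=(x_0,x_1,\dots,x_t)$, $t\ge 0$, $x_i\in X$; its best-so-far alternative is $y_t=\max\{x_0,\dots,x_t\}$; $\mathcal H(x_0)$ is the set of all such histories. A decision rule $p$ assigns to each history $h$ a stopping probability $p(h)\in[0,1]$; it is stationary if $p(h)$ depends on $h$ only through its best-so-far alternative, written $p(y)$. Given an environment $F$ and a history $h_t$, the future alternatives are i.i.d. with law $F$; at each round $s\ge t$ the individual stops with probability $p(h_s)$ (otherwise observes the next alternative), and stopping at round $s$ yields $\delta^{s-t}y_s$ (never stopping yields $0$). $U_p(F,h_t)$ is the expected payoff, and $V(F,h)=\sup_pU_p(F,h)$. A prior is a finitely supported probability distribution $\mu$ on $\mathcal F$; $\Delta(\mathcal F)$ is the set of priors. An environment or prior is consistent with $h_t$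 if $x_1,\dots,x_t$ occurs with positive probability under it; $\mathcal F(h)$, $\Delta(\mathcal F(h))$ denote the consistent ones. For consistent $\mu$, $U_p(\mu,h)=\sum_F\mu(F\mid h)U_p(F,h)$ with $\mu(\cdot\mid h)$ the Bayesian posterior, and $V(\mu,h)=\sup_pU_p(\mu,h)$. The performance ratio is $R_p(x_0,\mathcal F)=\inf_{h\in\mathcal H(x_0)}\inf_{\mu\in\Delta(\mathcal F(h))}U_p(\mu,h)/V(\mu,h)$, $R^*(x_0,\mathcal F)=\sup_pR_p(x_0,\mathcal F)$ over all decision rules, and $p$ is dynamically robust if $R_p(x_0,\mathcal F)=R^*(x_0,\mathcal F)$. *)

(* Defs.v *)
From mathcomp Require Import all_boot all_order all_algebra.
From mathcomp Require Import all_classical all_reals all_analysis.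
Set Implicit Arguments. Unset Strict Implicit. Unset Printing Implicit Defensive.
Import Order.TTheory GRing.Theory Num.Theory.
Local Open Scope classical_set_scope.
Local Open Scope ring_scope.

Section SearchModel.
Variable R : realType.

(* A history h_t = (x_0, x_1, ..., x_t) is represented by the list
   [:: x_0; x_1; ...; x_t]; new alternatives are appended with rcons. *)
Definition history := seq R.

Definition best (h : history) : R := \big[Num.max/0]_(x <- h) x.

Definition histories (X : set R) (x0 : R) : set history :=
  [set h | exists xs : seq R, h = x0 :: xs /\ (forall x, x \in xs -> X x)].

Definition decision_rule (p : history -> R) : Prop :=
  forall h, 0 <= p h <= 1.

Definition stationary (p : history -> R) : Prop :=
  exists q : R -> R, forall h, p h = q (best h).

Definition environment (X : set R) (F : probability R R) : Prop :=
  F X = 1%E /\ (F.-integrable setT (fun x : R => x%:E)).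

Definition likelihood (F : probability R R) (h : history) : R :=
  \prod_(x <- behead h) fine (F [set x]).

Definition consistent (F : probability R R) (h : history) : Prop :=
  0 < likelihood F h.

(* Expected payoff when the individual is forced to have stopped within the
   next N rounds (payoff 0 otherwise). *)
Fixpoint Utrunc (delta : R) (p : history -> R) (F : probability R R)
    (N : nat) (h : history) : \bar R :=
  match N with
  | 0 => (p h * best h)%:E
  | N'.+1 => ((p h * best h)%:E +
      ((1 - p h) * delta)%:E * \int[F]_x Utrunc delta p F N' (rcons h x))%E
  end.

(* U_p(F,h): expected payoff, limit of the (nondecreasing) truncations *)
Definition U (delta : R) (p : history -> R) (F : probability R R)
    (h : history) : \bar R :=
  ereal_sup (range (fun N => Utrunc delta p F N h)).

Definition V (delta : R) (F : probability R R) (h : history) : \bar R :=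
  ereal_sup [set U delta p F h | p in decision_rule].

(* Finitely supported priors are lists of (weight, environment) pairs. *)
Definition prior := seq (R * probability R R).

Definition consistent_prior (X : set R) (h : history) (mu : prior) : Prop :=
  (forall wF, wF \in mu -> 0 < wF.1 /\ environment X wF.2 /\ consistent wF.2 h)
  /\ \sum_(wF <- mu) wF.1 = 1.

Definition posterior (mu : prior) (h : history) (wF : R * probability R R) : R :=
  wF.1 * likelihood wF.2 h / \sum_(vG <- mu) vG.1 * likelihood vG.2 h.

Definition Uprior (delta : R) (p : history -> R) (mu : prior)
    (h : history) : \bar R :=
  (\sum_(wF <- mu) (posterior mu h wF)%:E * U delta p wF.2 h)%E.

Definition Vprior (delta : R) (mu : prior) (h : history) : \bar R :=
  ereal_sup [set Uprior delta p mu h | p in decision_rule].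

Definition perf_ratio (delta : R) (X : set R) (x0 : R)
    (p : history -> R) : \bar R :=
  ereal_inf [set r : \bar R | exists (h : history) (mu : prior),
    histories X x0 h /\ consistent_prior X h mu /\
    r = (Uprior delta p mu h / Vprior delta mu h)%E].

Definition opt_ratio (delta : R) (X : set R) (x0 : R) : \bar R :=
  ereal_sup [set perf_ratio delta X x0 p | p in decision_rule].

Definition dynamically_robust (delta : R) (X : set R) (x0 : R)
    (p : history -> R) : Prop :=
  perf_ratio delta X x0 p = opt_ratio delta X x0.

End SearchModel.

(* Main.v *)
(* (a) Let [c] be the reservation value of [F], i.e. [c = delta * E max(c, x)].
   Then [max(y, c)] is a supersolution of the Bellman recursion, so it bounds the
   payoff of every rule.  The constant rule satisfies [U = (1-rho)/2 * y +
   rho * E U] with [rho = delta / (2 - delta)], and [max(y, c/2) / 2 >=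
   max(y, c) / 4] is a subsolution of that recursion.
   (b) Suppose a rule guarantees [r > 1/4].  Let [b(h)] be the expected discount
   factor at stopping when only zeros follow [h].  Facing a rare jackpot [z], the
   rule earns at [h] at most about the fraction [(1 - b(h)) b'] of the value,
   where [b'] bounds the values of [b] right after the jackpot.  Hence
   [(1 - b) b' >= r], which forces [b' >= b + (r - 1/4)/2], and repeating this
   with ever larger jackpots contradicts [b <= 1]. *)

Require Import Defs.
From mathcomp Require Import all_boot all_order all_algebra.
From mathcomp Require Import all_classical all_reals all_analysis.
From mathcomp Require Import ring lra measurable_realfun.
From HB Require Import structures.
Set Implicit Arguments. Unset Strict Implicit. Unset Printing Implicit Defensive.
Import Order.TTheory GRing.Theory Num.Theory.
Local Open Scope classical_set_scope.
Local Open Scope ring_scope.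

(* The integral of an arbitrary function is a difference of suprema over simple
   functions, so monotonicity needs no measurability; decision rules are not
   assumed measurable. *)
Lemma le_integralT d (T : measurableType d) (R : realType)
    (m : {measure set T -> \bar R}) (f g : T -> \bar R) :
  (forall x, f x <= g x)%E -> (\int[m]_x f x <= \int[m]_x g x)%E.
Proof.
move=> fg; rewrite /integral !patch_setT; apply: leeB.
- apply: ereal_sup_le => _ [h hf <-]; exists h => // x.
  by apply: le_trans (hf x) _; rewrite !funeposE ge_max !le_max lexx orbT andbT fg.
- apply: ereal_sup_le => _ [h hf <-]; exists h => // x.
  apply: le_trans (hf x) _; rewrite !funenegE ge_max !le_max lexx orbT andbT.
  by rewrite leeN2 fg.
Qed.

(** * Best-so-far alternatives and truncated payoffs *)

Lemma best_rcons (R : realType) (h : history R) (x : R) :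
  best (rcons h x) = Num.max (best h) x.
Proof.
rewrite /best; elim: h => [|a h IH] /=; first by rewrite big_cons !big_nil maxC.
by rewrite !big_cons IH maxA.
Qed.

Lemma best_ge0 (R : realType) (h : history R) : 0 <= best h.
Proof.
by rewrite /best; elim: h => [|a h IH]; rewrite ?big_nil // big_cons le_max IH orbT.
Qed.

Lemma Utrunc_ge0 (R : realType) (delta : R) p F N h :
  0 <= delta -> decision_rule p -> (0 <= Utrunc delta p F N h)%E.
Proof.
move=> d0 hp; elim: N h => [|N IH] h /=; have /andP[p0 p1] := hp h.
  by rewrite lee_fin mulr_ge0 ?best_ge0.
rewrite adde_ge0 ?lee_fin ?mulr_ge0 ?best_ge0 ?subr_ge0 //.
by rewrite mule_ge0 ?lee_fin ?mulr_ge0 ?subr_ge0 // integral_ge0.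
Qed.

(** * Expected maximum and the reservation value of an environment *)

Definition Emax {R : realType} (F : probability R R) (c : R) : R :=
  fine (\int[F]_x (Num.max c x)%:E).

Section Emax.
Context {R : realType} (F : probability R R).
Hypothesis intF : F.-integrable setT (fun x : R => x%:E).

Lemma integral_EFin_cst b : (\int[F]_x (EFin \o cst b) x = b%:E)%E.
Proof.
apply: etrans (integral_cst F measurableT b%:E) _.
by rewrite -[RHS]mule1; congr (_ * _)%E; exact: probability_setT.
Qed.

Lemma integrable_max c : F.-integrable setT (fun x : R => (Num.max c x)%:E).
Proof.
have ic : F.-integrable setT (EFin \o cst `|c|).
  exact: finite_measure_integrable_cst.
apply: le_integrable (integrableD measurableT ic (integrable_abse intF)) => //.
  by apply/measurable_EFinP; apply: measurable_maxr.
move=> x _ /=; rewrite lee_fin [leRHS]ger0_norm ?addr_ge0 //.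
by case: (leP c x) => _; rewrite ?lerDl ?lerDr.
Qed.

Lemma EmaxE c : (\int[F]_x (Num.max c x)%:E = (Emax F c)%:E)%E.
Proof. by rewrite /Emax fineK // integrable_fin_num // integrable_max. Qed.

Lemma integral_affine_max a b c :
  (\int[F]_x (a * Num.max c x + b)%:E = (a * Emax F c + b)%:E)%E.
Proof.
have ic : F.-integrable setT (EFin \o cst b).
  exact: finite_measure_integrable_cst.
have im := integrableZl measurableT a (integrable_max c).
have := integralD measurableT im ic.
rewrite integralZl ?EmaxE //; last exact: integrable_max.
by rewrite integral_EFin_cst EFinD EFinM => <-.
Qed.

(** Pointwise comparison under the integral, stated once in affine form; monotonicity, the Lipschitz
    bound and [c <= Emax F c] are instances. *)
Lemma le_Emax_affine a b c a' b' c' :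
  (forall x, a * Num.max c x + b <= a' * Num.max c' x + b') ->
  a * Emax F c + b <= a' * Emax F c' + b'.
Proof.
move=> h; rewrite -lee_fin -!integral_affine_max.
by apply: le_integralT => x; rewrite lee_fin.
Qed.

Lemma le_Emax c d : c <= d -> Emax F c <= Emax F d.
Proof.
move=> cd; have := @le_Emax_affine 1 0 c 1 0 d; rewrite !mul1r !addr0; apply.
by move=> x; rewrite !mul1r !addr0 ge_max !le_max cd lexx orbT.
Qed.

Lemma EmaxD c t : 0 <= t -> Emax F (c + t) <= Emax F c + t.
Proof.
move=> t0; have := @le_Emax_affine 1 0 (c + t) 1 t c; rewrite !mul1r !addr0; apply.
by move=> x; rewrite !mul1r !addr0; case: (leP c x); case: (leP (c + t) x); lra.
Qed.

Lemma Emax_ge c : c <= Emax F c.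
Proof.
have := @le_Emax_affine 0 c 0 1 0 c; rewrite !mul0r add0r mul1r addr0; apply.
by move=> x; rewrite mul0r add0r mul1r addr0 le_max lexx.
Qed.

(** A monotone fixed-point argument: [c] is the supremum of the points lying below their image under
    [c |-> delta * Emax F c]. Since [Emax F c <= Emax F 0 + c], the slope [delta < 1] bounds this
    set. *)
Lemma reservation_value delta : 0 < delta < 1 ->
  exists2 c, 0 <= c & c = delta * Emax F c.
Proof.
move=> /andP[d0 d1].
pose S := [set c | 0 <= c /\ c <= delta * Emax F c].
have S0 : S 0 by split => //; rewrite mulr_ge0 ?Emax_ge // ltW.
have bS : ubound S (delta * Emax F 0 / (1 - delta)).
  move=> c [c0 cS]; rewrite ler_pdivlMr ?subr_gt0 //.
  have := EmaxD 0 c0; rewrite add0r => h.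
  have : delta * Emax F c <= delta * (Emax F 0 + c) by rewrite ler_wpM2l // ltW.
  by nra.
have hb : has_ubound S by exists (delta * Emax F 0 / (1 - delta)).
have c0 : 0 <= sup S by exact: ub_le_sup.
have le1 : sup S <= delta * Emax F (sup S).
  apply: ge_sup; first by exists 0.
  move=> c cS; apply: le_trans cS.2 _; rewrite ler_wpM2l ?(ltW d0) // le_Emax //.
  exact: ub_le_sup.
(* By monotonicity the image of [sup S] lies again in [S], hence below [sup S]. *)
exists (sup S) => //; apply/eqP; rewrite eq_le le1 /=; apply: ub_le_sup => //.
split; first exact: le_trans le1.
by rewrite ler_wpM2l ?(ltW d0) // le_Emax.
Qed.

(** * Super- and subsolutions of the Bellman recursion *)

Lemma Utrunc_le_reservation delta p c N h : 0 < delta < 1 -> decision_rule p ->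
  0 <= c -> c = delta * Emax F c ->
  (Utrunc delta p F N h <= (Num.max (best h) c)%:E)%E.
Proof.
move=> /andP[d0 d1] hp c0 cE.
elim: N h => [|N IH] h /=; have /andP[p0 p1] := hp h; set b := best h.
  have b0 : 0 <= b by exact: best_ge0.
  by rewrite lee_fin le_max; apply/orP; left; nra.
set M := Num.max b c.
have Mb : b <= M by rewrite le_max lexx.
have Mc : c <= M by rewrite le_max lexx orbT.
have I : (\int[F]_x Utrunc delta p F N (rcons h x) <= (Emax F M)%:E)%E.
  rewrite -EmaxE; apply: le_integralT => x; apply: le_trans (IH _) _.
  by rewrite best_rcons maxAC.
(* From its fixed point [c] on, [delta * Emax F] grows with slope at most [delta], so it stays below
   the diagonal at [M >= c]. *)
have EM : delta * Emax F M <= M.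
  have := @EmaxD c (M - c); rewrite subr_ge0 => /(_ Mc).
  rewrite addrC subrK => h1.
  have : delta * Emax F M <= delta * (Emax F c + (M - c)) by rewrite ler_wpM2l // ltW.
  by rewrite mulrDr -cE; nra.
apply: (@le_trans _ _ ((p h * b)%:E + ((1 - p h) * delta)%:E * (Emax F M)%:E)%E).
  rewrite leeD2l // lee_wpmul2l // lee_fin mulr_ge0 ?subr_ge0 //; exact: ltW.
by rewrite -EFinM -EFinD lee_fin -mulrA; nra.
Qed.

(* The bound [rho * E max(c/2, x) >=
   rho * (c/delta - c/2) = c/2] makes [max(best h, c/2) / 2] a subsolution; the
   term in [delta ^+ N] absorbs the truncation, and [C] is chosen so that this
   error contracts by the factor [delta]. *)
Lemma Utrunc_const_ge delta (c C : R) N h : 0 < delta < 1 ->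
  let rho := delta / (2 - delta) in
  0 <= c -> c = delta * Emax F c -> c / 2 <= C ->
  rho * Emax F 0 <= (delta - rho) * C ->
  ((2^-1 * (Num.max (best h) (c / 2) - delta ^+ N * (best h + C)))%R%:E <=
   Utrunc delta (fun _ => ((1 - delta) / (2 - delta))%R) F N h)%E.
Proof.
move=> /andP[d0 d1] rho c0 cE cC rC.
have r0 : 0 < rho by rewrite divr_gt0 //; lra.
(* In terms of [rho], the rule stops with probability [(1 - rho) / 2] and discounts continuation by
   exactly [rho]. *)
have qE : (1 - delta) / (2 - delta) = (1 - rho) / 2 by rewrite /rho; field; lra.
have rE : (1 - (1 - rho) / 2) * delta = rho by rewrite /rho; field; lra.
have r1 : rho < 1 by rewrite /rho ltr_pdivrMr; lra.
rewrite qE.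
elim: N h => [|N IH] h; cbn [Utrunc]; set b := best h;
  have b0 : 0 <= b by exact: best_ge0.
  (* At [N = 0] the error term has weight 1, and [c / 2 <= C] makes the left side nonpositive. *)
  rewrite lee_fin expr0 mul1r; apply: (@le_trans _ _ 0); last by nra.
  by case: (leP b (c / 2)); lra.
set M := Num.max b (c / 2); set e := delta ^+ N; rewrite rE.
have e0 : 0 <= e by rewrite exprn_ge0 // ltW.
have MI : (((Emax F M - e * (Emax F b + C)) / 2)%R%:E <=
  \int[F]_x Utrunc delta (fun _ => ((1 - rho) / 2)%R) F N (rcons h x))%E.
  apply: (@le_trans _ _ (\int[F]_x
    ((2^-1 * (Num.max M x - e * (Num.max b x + C)))%R%:E))%E); last first.
    by apply: le_integralT => x; apply: le_trans (IH _); rewrite best_rcons maxAC.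
  have i1 := integrableZl measurableT (2^-1) (integrable_max M).
  have i2 := integrableZl measurableT (- e / 2) (integrable_max b).
  have i3 : F.-integrable setT (EFin \o cst (- e * C / 2)).
    exact: finite_measure_integrable_cst.
  have E1 := integralD measurableT i1 i2.
  rewrite (integralZl measurableT (integrable_max M)) in E1.
  rewrite (integralZl measurableT (integrable_max b)) !EmaxE in E1.
  have E2 := integralD measurableT (integrableD measurableT i1 i2) i3.
  rewrite [X in (X + _)%E]E1 integral_EFin_cst -!EFinM -!EFinD in E2.
  rewrite le_eqVlt; apply/orP; left; apply/eqP.
  transitivity (2^-1 * Emax F M + - e / 2 * Emax F b + - e * C / 2)%R%:E.
    by congr EFin; field.
  rewrite -E2; apply: eq_integral => x _ /=.
  by rewrite -!EFinM -!EFinD; congr EFin; field.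
apply: (@le_trans _ _ (((1 - rho) / 2 * b)%R%:E +
  rho%:E * ((Emax F M - e * (Emax F b + C)) / 2)%R%:E)%E); last first.
  by rewrite leeD2l // lee_wpmul2l // lee_fin ltW.
rewrite -EFinM -EFinD lee_fin exprS -/e.
have Eb : Emax F b <= Emax F 0 + b by have := EmaxD 0 b0; rewrite add0r.
have rd : rho <= delta by rewrite /rho ler_pdivrMr; nra.
(* The error contracts: [Emax F b <= Emax F 0 + b], and the excess [rho * Emax F 0] is paid by
   [(delta - rho) * C]. *)
have h1 : rho * e * (Emax F b + C) <= delta * e * (b + C).
  have : rho * (Emax F b + C) <= delta * (b + C).
    have : rho * Emax F b <= rho * (Emax F 0 + b) by rewrite ler_wpM2l // ltW.
    have : rho * b <= delta * b by rewrite ler_wpM2r.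
    by lra.
  by move=> /(ler_wpM2l e0); lra.
suff h2 : M <= (1 - rho) * b + rho * Emax F M by nra.
have hM : M <= Emax F M by exact: Emax_ge.
rewrite {1}/M; case: (leP b (c / 2)) => bc; last first.
  have : b <= M by rewrite le_max lexx.
  move=> bM; have := ler_wpM2l (ltW r0) (le_trans bM hM).
  by lra.
have h3 : c / delta - c / 2 <= Emax F M.
  have -> : c / delta = Emax F c by rewrite {1}cE mulrC mulKf // gt_eqF.
  have : Emax F (c / 2 + c / 2) <= Emax F (c / 2) + c / 2 by apply: EmaxD; lra.
  have : Emax F (c / 2) <= Emax F M by apply: le_Emax; rewrite le_max lexx orbT.
  rewrite (_ : c / 2 + c / 2 = c); [lra|by field].
(* This identity is where the particular stopping probability matters:
   [rho * (1 / delta - 1 / 2) = 1 / 2]. *)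
have : rho * (c / delta - c / 2) = c / 2 by rewrite /rho; field; lra.
have := ler_wpM2l (ltW r0) h3; have : 0 <= (1 - rho) * b by rewrite mulr_ge0 // subr_ge0 ltW.
by lra.
Qed.

End Emax.

(** * Removing the truncation; the factor 4 in a fixed environment *)

Lemma le_of_geometric_error (R : realType) (delta a k u : R) :
  0 < delta < 1 -> (forall N, a - delta ^+ N * k <= u) -> a <= u.
Proof.
move=> /andP[d0 d1] h.
have cv : (fun N => a - delta ^+ N * k) @ \oo --> a - 0 * k.
  apply: cvgB; first exact: cvg_cst.
  by apply: cvgMr_tmp; apply: cvg_expr; rewrite ger0_norm // ltW.
by rewrite mul0r subr0 in cv; apply: (cvgr_to_le cv); near=> N; exact: h.
Unshelve. all: by end_near. Qed.

Lemma lee_of_geometric_error (R : realType) (delta a k : R) (u : \bar R) :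
  0 < delta < 1 -> (forall N, ((a - delta ^+ N * k)%R%:E <= u)%E) ->
  (a%:E <= u)%E.
Proof.
case: u => [u| |] hd h; last by have := h 0.
  by rewrite lee_fin; apply: (le_of_geometric_error (k := k) hd) => N; rewrite -lee_fin.
by rewrite leey.
Qed.

Lemma sum_seq_gt0 (R : realType) (T : eqType) (s : seq T) (f : T -> R) :
  s != [::] -> (forall x, x \in s -> 0 < f x) -> 0 < \sum_(x <- s) f x.
Proof.
case: s => // a s _ h; rewrite big_cons ltr_pwDl ?h ?mem_head //.
rewrite big_seq sumr_ge0 // => x xs.
by rewrite ltW // h // in_cons xs orbT.
Qed.

Section FixedEnvironment.
Context {R : realType} (delta : R) (X : set R) (F : probability R R).
Hypotheses (hd : 0 < delta < 1) (envF : environment X F).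
Let pbar := fun _ : history R => (1 - delta) / (2 - delta).

Lemma decision_rule_pbar : decision_rule pbar.
Proof.
move=> h; case/andP: hd => d0 d1; rewrite /pbar divr_ge0 ?ler_pdivrMr; lra.
Qed.

(** The single number [w = max(best h, c)], with [c] the reservation value, serves both sides, so
    the optimal value is never computed. *)
Lemma U_bounds h : exists2 w, best h <= w &
  (forall p, decision_rule p -> (U delta p F h <= w%:E)%E) /\
  ((w / 4)%R%:E <= U delta pbar F h)%E.
Proof.
have [_ intF] := envF.
have [c c0 cE] := reservation_value intF hd.
exists (Num.max (best h) c); first by rewrite le_max lexx.
split=> [p hp|].
  apply: ge_ereal_sup => _ [N _ <-].
  exact: (Utrunc_le_reservation intF).
case/andP: (hd) => d0 d1; set rho := delta / (2 - delta).
have rd : rho < delta by rewrite /rho ltr_pdivrMr; nra.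
have r0 : 0 < rho by rewrite divr_gt0 //; lra.
(* The least constant meeting both requirements of [Utrunc_const_ge]. *)
pose C := Num.max (c / 2) (rho * Emax F 0 / (delta - rho)).
have C1 : c / 2 <= C by rewrite /C le_max lexx.
have C2 : rho * Emax F 0 <= (delta - rho) * C.
  by rewrite [leRHS]mulrC -ler_pdivrMr ?subr_gt0 // /C le_max lexx orbT.
have b0 : 0 <= best h by exact: best_ge0.
apply: (@le_trans _ _ (2^-1 * Num.max (best h) (c / 2))%:E).
  rewrite lee_fin.
  by case: (leP (best h) c); case: (leP (best h) (c / 2)); lra.
apply: (lee_of_geometric_error (k := 2^-1 * (best h + C)) hd) => N.
apply: le_trans (ereal_sup_ubound _); last by exists N.
apply: le_trans (Utrunc_const_ge intF N h hd c0 cE C1 C2).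
by rewrite lee_fin mulrBr mulrCA.
Qed.

Lemma le_U_4pbar h p : decision_rule p ->
  (U delta p F h <= 4%:E * U delta pbar F h)%E.
Proof.
have [w _ [ub lb]] := U_bounds h => hp; apply: le_trans (ub _ hp) _.
apply: le_trans (lee_wpmul2l _ lb); last by rewrite lee_fin.
by rewrite -EFinM lee_fin mulrC divfK.
Qed.

Lemma U_pbar_fin_num h : U delta pbar F h \is a fin_num.
Proof.
have [w bw [ub lb]] := U_bounds h.
rewrite fin_real // (lt_le_trans _ lb) ?ltNyr //=.
by rewrite (le_lt_trans (ub _ decision_rule_pbar)) // ltry.
Qed.

Lemma U_pbar_gt0 h : 0 < best h -> (0 < U delta pbar F h)%E.
Proof.
have [w bw [ub lb]] := U_bounds h => b0; apply: lt_le_trans lb.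
by rewrite lte_fin; lra.
Qed.

End FixedEnvironment.

(** * From environments to priors: the guarantee of part (a) *)

Lemma best_histories_gt0 (R : realType) (X : set R) (x0 : R) h :
  0 < x0 -> histories X x0 h -> 0 < best h.
Proof.
move=> x00 [xs [-> _]]; rewrite /best big_cons; apply: lt_le_trans x00 _.
by rewrite le_max lexx.
Qed.

(** Posterior weights do not depend on the rule, so the factor 4 of each environment survives
    averaging. The bounds also show that the quotient in the performance ratio has a finite positive
    denominator. *)
Lemma prior_bounds (R : realType) (delta : R) (X : set R) (x0 : R) h mu :
  0 < delta < 1 -> 0 < x0 -> histories X x0 h -> consistent_prior X h mu ->
  let pbar := fun _ : history R => (1 - delta) / (2 - delta) in
  exists2 u : R, 0 < u & [/\ Uprior delta pbar mu h = u%:E,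
    (u%:E <= Vprior delta mu h)%E & (Vprior delta mu h <= (4 * u)%R%:E)%E].
Proof.
move=> hd x00 hh [hmu mu1] pbar.
have b0 := best_histories_gt0 x00 hh.
have mu0 : mu != [::].
  by apply/eqP => E; move: mu1; rewrite E big_nil => /eqP; rewrite eq_sym oner_eq0.
have envF wF : wF \in mu -> environment X wF.2 by move=> /hmu[_ []].
have wL wF : wF \in mu -> 0 < wF.1 * likelihood wF.2 h.
  by move=> /hmu[w0 [_ c0]]; rewrite mulr_gt0.
have post0 wF : wF \in mu -> 0 < posterior mu h wF.
  by move=> wmu; rewrite divr_gt0 ?wL // sum_seq_gt0.
pose u (wF : R * probability R R) := fine (U delta pbar wF.2 h).
have uE wF : wF \in mu -> U delta pbar wF.2 h = (u wF)%:E.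
  by move=> wmu; rewrite fineK // (U_pbar_fin_num hd (envF _ wmu)).
have UE : Uprior delta pbar mu h = (\sum_(wF <- mu) posterior mu h wF * u wF)%:E.
  rewrite -sumEFin /Uprior !big_seq; apply: eq_bigr => wF wmu.
  by rewrite (uE _ wmu) EFinM.
exists (\sum_(wF <- mu) posterior mu h wF * u wF).
  apply: sum_seq_gt0 => // wF wmu; rewrite mulr_gt0 ?post0 // -lte_fin -uE //.
  exact: (U_pbar_gt0 hd (envF _ wmu)).
split=> //.
  rewrite -UE; apply: ereal_sup_ubound; exists pbar => //.
  exact: decision_rule_pbar.
apply: ge_ereal_sup => _ [p hp <-].
rewrite mulr_sumr -sumEFin /Uprior !big_seq; apply: lee_sum => wF wmu.
rewrite mulrCA [leRHS]EFinM lee_wpmul2l ?lee_fin ?(ltW (post0 _ wmu)) //.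
by rewrite EFinM -uE //; exact: (le_U_4pbar hd (envF _ wmu) h hp).
Qed.

Lemma perf_ratio_pbar_ge (R : realType) (delta : R) (X : set R) (x0 : R) :
  0 < delta < 1 -> 0 < x0 ->
  ((1 / 4)%R%:E <= perf_ratio delta X x0
     (fun _ : history R => ((1 - delta) / (2 - delta))%R))%E.
Proof.
move=> hd x00; apply: le_ereal_inf_tmp => _ [h [mu [hh [hmu ->]]]].
have [u u0 [-> ]] := prior_bounds hd x00 hh hmu.
case: (Vprior delta mu h) => [v| |] //; rewrite !lee_fin => uv vu.
have v0 : 0 < v by exact: lt_le_trans uv.
by rewrite inver gt_eqF // -EFinM lee_fin ler_pdivlMr //; lra.
Qed.

(** * Construction of jackpot environments *)

Section Mixture.
Context {R : realType} (t : R) (t01 : 0 <= t <= 1) (P Q : probability R R).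

Let t0 : 0 <= t. Proof. by case/andP: t01. Qed.
Let onem_t0 : 0 <= 1 - t. Proof. by rewrite subr_ge0; case/andP: t01. Qed.

Let mix := measure_add (mscale (NngNum onem_t0) P) (mscale (NngNum t0) Q).

Let mix_setT : mix setT = 1%E.
Proof.
rewrite /mix measure_addE /mscale /=.
transitivity ((1 - t)%R%:E * 1 + t%:E * 1)%E.
  by congr (_ * _ + _ * _)%E; exact: probability_setT.
by rewrite !mule1 -EFinD subrK.
Qed.

HB.instance Definition _ := Measure.on mix.
HB.instance Definition _ := Measure_isProbability.Build _ _ _ mix mix_setT.

Lemma mixture_exists : exists F : probability R R,
  forall A, F A = ((1 - t)%R%:E * P A + t%:E * Q A)%E.
Proof. by exists mix => A; exact: measure_addE. Qed.

End Mixture.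

(** Start from the point mass at 0 and mix in one point mass at a time with weight 1/2. This later
    makes a given history consistent. *)
Lemma charging_probability (R : realType) (s : seq R) :
  exists F : probability R R,
    (forall x, x \in s -> 0 < F [set x])%E /\
    (forall A, (forall x, x \in 0 :: s -> ~ A x) -> F A = 0%E).
Proof.
elim: s => [|a s [G [Gs G0]]].
  exists \d_(0 : R); split=> // A /(_ 0); rewrite mem_head => /(_ isT) nA.
  by rewrite /= diracE memNset.
have h2 : 0 <= (2^-1 : R) <= 1 by apply/andP; split; lra.
have [F FE] := mixture_exists h2 G (\d_a).
exists F; split=> [x|A nA]; rewrite FE /=.
  rewrite in_cons => /orP[/eqP ->|xs].
    apply: lt_le_trans (leeDr _ _); last by rewrite mule_ge0 // lee_fin; lra.
    by rewrite diracE mem_set // mule1 lte_fin; lra.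
  apply: lt_le_trans (leeDl _ _); last by rewrite mule_ge0 // lee_fin; lra.
  by rewrite mule_gt0 ?Gs // lte_fin; lra.
rewrite G0 ?mule0 ?add0e.
  by rewrite diracE memNset ?mule0 //; apply: nA; rewrite !in_cons eqxx orbT.
by move=> x xs; apply: nA; move: xs; rewrite !in_cons => /orP[->|->]; rewrite ?orbT.
Qed.

(* The mass [k] strictly between [0] and [z] only serves to make a given
   history consistent with [F]. *)
Definition jackpot {R : realType} (F : probability R R) (z e k : R) : Prop :=
  [/\ ((1 - e - k)%R%:E <= F [set 0%R])%E, F [set z] = e%:E,
      (F `]0%R, z[%classic <= k%:E)%E & F (~` `[0%R, z]%classic) = 0%E].

(** * Integrals against a jackpot environment *)

Lemma measurable_indic_sum d (T : measurableType d) (R : realType)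
    (s : seq (\bar R * set T)) : (forall c, c \in s -> measurable c.2) ->
  measurable_fun setT (fun x => (\sum_(c <- s) c.1 * (\1_c.2 x)%:E)%E).
Proof.
elim: s => [|c s IH] sm.
  by under eq_fun do rewrite big_nil; exact: measurable_cst.
under eq_fun do rewrite big_cons; apply: emeasurable_funD; last first.
  by apply: IH => k ks; apply: sm; rewrite in_cons ks orbT.
apply/measurable_funeM/measurable_EFinP/measurable_indic.
by apply: sm; rewrite mem_head.
Qed.

(** Coefficients are extended reals so that a null set may carry the value [+oo]. *)
Lemma integral_indic_sum d (T : measurableType d) (R : realType)
    (m : {measure set T -> \bar R}) (s : seq (\bar R * set T)) :
  (forall c, c \in s -> (0 <= c.1)%E) -> (forall c, c \in s -> measurable c.2) ->
  (\int[m]_x (\sum_(c <- s) c.1 * (\1_c.2 x)%:E) = \sum_(c <- s) c.1 * m c.2)%E.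
Proof.
elim: s => [|[c A] s IH] s0 sm.
  by rewrite big_nil; apply: integral0_eq => x _; rewrite big_nil.
have c0 : (0 <= c)%E := s0 _ (mem_head _ _).
have mA : measurable A := sm _ (mem_head _ _).
have {}s0 k : k \in s -> (0 <= k.1)%E by move=> ks; rewrite s0 // in_cons ks orbT.
have {}sm k : k \in s -> measurable k.2 by move=> ks; apply: sm; rewrite in_cons ks orbT.
rewrite big_cons /= -IH //.
have mi (B : set T) : measurable B -> measurable_fun setT (fun x => (\1_B x)%:E : \bar R).
  by move=> mB; apply/measurable_EFinP; exact: measurable_indic.
have i0 (B : set T) x : (0 <= (\1_B x)%:E :> \bar R)%E by rewrite lee_fin.
rewrite -[in RHS](setIT A) -integral_indic // -ge0_integralZl //; last exact: mi.
rewrite -ge0_integralD //.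
- by apply: eq_integral => x _; rewrite big_cons.
- by move=> x _; rewrite mule_ge0.
- exact/measurable_funeM/mi.
- by move=> x _; rewrite big_seq sume_ge0 // => k ks; rewrite mule_ge0 // s0.
- exact: measurable_indic_sum.
Qed.

Section JackpotIntegral.
Context {R : realType} (F : probability R R) (z e k : R).
Hypotheses (jF : jackpot F z e k) (z0 : 0 < z).

(** [f] is dominated by a step function on four pieces; the value [+oo] off [[0, z]] costs nothing
    on a null set. The mass at 0 is bounded crudely by 1. *)
Lemma integral_le_jackpot (f : R -> \bar R) (a b : R) : 0 <= a -> 0 <= b ->
  (f 0%R <= a%:E)%E -> (f z <= b%:E)%E ->
  (forall x, 0 <= x <= z -> (f x <= z%:E)%E) ->
  (\int[F]_x f x <= (a + e * b + k * z)%R%:E)%E.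
Proof.
have [F0 Fz Fm Fc] := jF => a0 b0 f0 fz fx.
pose s : seq (\bar R * set R) :=
  [:: (a%:E, [set 0%R]); (b%:E, [set z]); (z%:E, `]0%R, z[%classic);
      (+oo, ~` `[0%R, z]%classic)]%E.
have s0 kA : kA \in s -> (0 <= kA.1)%E.
  by rewrite !inE => /or4P[] /eqP -> //=; rewrite ?lee_fin ?ltW // leey.
have sm kA : kA \in s -> measurable kA.2.
  by rewrite !inE => /or4P[] /eqP -> //=; apply: measurableC.
have ind0 (A : set R) x : (0 <= (\1_A x)%:E)%E by rewrite lee_fin.
apply: (@le_trans _ _ (\int[F]_x (\sum_(kA <- s) kA.1 * (\1_kA.2 x)%:E))%E).
  apply: le_integralT => x; rewrite !big_cons big_nil /= adde0 !indicE.
  have t0 (c : \bar R) (b' : bool) : (0 <= c -> 0 <= c * b'%:R%:E)%E.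
    by move=> c0; rewrite mule_ge0 // lee_fin.
  have [->|x0] := eqVneq x 0%R.
    rewrite [0%R \in [set 0%R]]mem_set // mule1.
    apply: le_trans f0 _; rewrite leeDl // ?adde_ge0 ?t0 ?lee_fin ?(ltW z0) ?leey //.
  have [->|xz] := eqVneq x z.
    rewrite [z \in [set z]]mem_set // mule1.
    apply: le_trans fz _; rewrite addeCA leeDl // ?adde_ge0 ?t0 ?lee_fin ?(ltW z0) ?leey //.
  have [xI|xI] := boolP (x \in `[0%R, z]).
    rewrite [x \in `]0%R, z[%classic]mem_set ?mule1; last first.
      by move: xI; rewrite /= !in_itv /= !lt_neqAle eq_sym x0 xz => /andP[-> ->].
    apply: le_trans (fx _ _) _; first by move: xI; rewrite in_itv.
    rewrite addeCA addeC -!addeA addeCA leeDl // ?adde_ge0 ?t0 ?lee_fin ?(ltW z0) ?leey //.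
  rewrite [x \in ~` _]mem_set ?mule1; last by move=> /= xI'; rewrite xI' in xI.
  apply: le_trans (leey _) _.
  by rewrite !addeA leeDr ?adde_ge0 ?t0 ?lee_fin ?(ltW z0).
rewrite integral_indic_sum // !big_cons big_nil /= adde0.
have h0 : (a%:E * F [set 0%R] <= a%:E)%E.
  by rewrite -[leRHS]mule1 lee_wpmul2l ?lee_fin //; exact: probability_le1.
have hm : (z%:E * F `]0%R, z[%classic <= (k * z)%R%:E)%E.
  by rewrite EFinM muleC lee_wpmul2r ?lee_fin ?(ltW z0).
rewrite Fz Fc mule0 adde0 -EFinM addeA [leRHS]EFinD; apply: leeD => //.
by rewrite [leRHS]EFinD [(e * b)%R]mulrC leeD.
Qed.

End JackpotIntegral.

Lemma jackpot_le_integral (R : realType) (F : probability R R) (z e k : R)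
    (f : R -> \bar R) (a b : R) :
  jackpot F z e k -> 0 < z -> 0 <= a -> 0 <= b -> (forall x, (0 <= f x)%E) ->
  (a%:E <= f 0%R)%E -> (b%:E <= f z)%E ->
  (((1 - e - k) * a + e * b)%R%:E <= \int[F]_x f x)%E.
Proof.
move=> [F0 Fz _ _] z0 a0 b0 f0 fa fb.
pose s : seq (\bar R * set R) := [:: (a%:E, [set 0%R]); (b%:E, [set z])]%E.
have s0 c : c \in s -> (0 <= c.1)%E.
  by rewrite !inE => /orP[] /eqP -> //=; rewrite lee_fin.
have sm c : c \in s -> measurable c.2.
  by rewrite !inE => /orP[] /eqP -> /=; exact: measurable_set1.
apply: (@le_trans _ _ (\int[F]_x (\sum_(c <- s) c.1 * (\1_c.2 x)%:E))%E).
  rewrite integral_indic_sum // !big_cons big_nil /= adde0 Fz EFinD -EFinM.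
  rewrite [(b * e)%R]mulrC leeD // EFinM muleC lee_wpmul2l // lee_fin.
apply: le_integralT => x; rewrite !big_cons big_nil /= adde0 !indicE.
have [->|x0] := eqVneq x 0%R.
  rewrite mem_set // mule1 memNset ?mule0 ?adde0 // => /= E.
  by rewrite E ltxx in z0.
rewrite memNset ?mule0 ?add0e; last by move=> /= E; rewrite E eqxx in x0.
have [->|xz] := eqVneq x z; first by rewrite mem_set // mule1.
by rewrite memNset ?mule0 // => /= E; rewrite E eqxx in xz.
Qed.

Lemma jackpot_integrable (R : realType) (F : probability R R) (z e k : R) :
  jackpot F z e k -> 0 < z -> F.-integrable setT (fun x : R => x%:E).
Proof.
move=> jF z0; apply/integrableP; split; first exact/measurable_EFinP.
apply: (@le_lt_trans _ _ (0 + e * z + k * z)%R%:E); last exact: ltry.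
apply: integral_le_jackpot; rewrite ?(ltW z0) //=; last 2 first.
- by rewrite lee_fin ger0_norm // ltW.
- by move=> x /andP[x0 xz]; rewrite lee_fin ger0_norm.
- by rewrite normr0.
Qed.

(** The law is [(1 - e) * ((1 - k) * \d_0 + k * nu) + e * \d_z], where [nu] charges the points of
    [s]; its mass at 0 is at least [(1 - e) * (1 - k) >= 1 - e - k]. *)
Lemma jackpot_exists (R : realType) (X : set R) (s : seq R) (z e k : R) :
  measurable X -> X 0 -> X z -> (forall x, x \in s -> X x /\ 0 <= x < z) ->
  0 < z -> 0 <= e -> 0 < k -> e + k < 1 ->
  exists F : probability R R,
    [/\ jackpot F z e k, environment X F & forall x, x \in s -> (0 < F [set x])%E].
Proof.
move=> mX X0 Xz sX z0 e0 k0 ek1.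
have [nu [nus nu0]] := charging_probability s.
have k01 : 0 <= k <= 1 by apply/andP; split; lra.
have e01 : 0 <= e <= 1 by apply/andP; split; lra.
have [G GE] := mixture_exists k01 \d_(0 : R) nu.
have [F FE] := mixture_exists e01 G \d_z.
have s0 x : x \in 0 :: s -> X x /\ 0 <= x < z.
  by rewrite in_cons => /orP[/eqP ->|/sX //]; rewrite lexx z0.
have jF : jackpot F z e k.
  split; rewrite FE GE /= !diracE.
  - rewrite mem_set // memNset /=; last by move=> E; rewrite E ltxx in z0.
    rewrite mule1 mule0 adde0 muleDr ?fin_num_adde_defr //.
    apply: le_trans (leeDl _ _).
      by rewrite -EFinM lee_fin; nra.
    by rewrite !mule_ge0 // lee_fin; lra.
  - rewrite memNset /=; last by move=> E; rewrite E ltxx in z0.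
    rewrite mem_set // nu0; last by move=> x /s0[_ /andP[_ xz]] E; rewrite E ltxx in xz.
    by rewrite !mule0 adde0 mule0 add0e mule1.
  - rewrite memNset /=; last by rewrite in_itv /= ltxx.
    rewrite memNset /=; last by rewrite in_itv /= ltxx andbF.
    rewrite !mule0 add0e adde0 muleA -EFinM.
    apply: (@le_trans _ _ (((1 - e) * k)%R%:E * 1)%E).
      rewrite lee_wpmul2l ?probability_le1 // lee_fin mulr_ge0 //; lra.
    by rewrite mule1 lee_fin; nra.
  - rewrite memNset /=; last by rewrite in_itv /= lexx (ltW z0); apply.
    rewrite memNset /=; last by rewrite in_itv /= lexx (ltW z0); apply.
    rewrite nu0 ?mule0 ?adde0 ?mule0 //.
    by move=> x /s0[_ /andP[x0 xz]] /=; rewrite in_itv /= x0 (ltW xz); apply.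
exists F; split=> //.
- split; last exact: jackpot_integrable jF z0.
  have := probability_setC F (measurableC mX); rewrite setCK => ->.
  suff -> : F (~` X) = 0%E by rewrite sube0.
  rewrite FE GE /= !diracE memNset; last by apply.
  rewrite memNset; last by apply.
  by rewrite nu0 ?mule0 ?adde0 ?mule0 // => x /s0[Xx _]; apply.
- move=> x xs; rewrite FE GE.
  apply: lt_le_trans (leeDl _ _); last by rewrite mule_ge0 ?lee_fin.
  rewrite mule_gt0 ?lte_fin //; first by lra.
  apply: lt_le_trans (leeDr _ _); last by rewrite mule_ge0 ?lee_fin //; lra.
  by rewrite mule_gt0 ?lte_fin // nus.
Qed.

(** * Upper bounds on the payoff of a rule facing a jackpot *)

(* Expected discount factor at the stopping time when the rule [p] stops within
   [M] rounds and every new alternative is [0]. *)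
Fixpoint zero_discount {R : realType} (delta : R) (p : history R -> R)
    (M : nat) (h : history R) : R :=
  if M is M'.+1 then
    p h + (1 - p h) * delta * zero_discount delta p M' (rcons h 0)
  else 0.

Lemma zero_discount_itv (R : realType) (delta : R) p M h :
  0 < delta < 1 -> decision_rule p -> 0 <= zero_discount delta p M h <= 1.
Proof.
move=> /andP[d0 d1] hp; elim: M h => [|M IH] h /=; first by rewrite lexx ler01.
have /andP[p0 p1] := hp h; have /andP[z0 z1] := IH (rcons h 0).
set zd := zero_discount _ _ _ _ in z0 z1 *.
have dz0 : 0 <= delta * zd by rewrite mulr_ge0 // ltW.
have dz1 : delta * zd <= 1 by nra.
by rewrite -mulrA; apply/andP; split; nra.
Qed.

Lemma rcons_cat_nseq (T : Type) (s : seq T) m (x : T) :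
  rcons (s ++ nseq m x) x = s ++ nseq m.+1 x.
Proof. by rewrite -cats1 -catA cats1; congr cat; elim: m => //= m ->. Qed.

Section Jackpot.
Context {R : realType} (delta : R) (F : probability R R) (z e k : R).
Hypotheses (hd : 0 < delta < 1) (jF : jackpot F z e k) (z0 : 0 < z).
Hypotheses (e0 : 0 < e) (k0 : 0 < k) (small : delta * (1 + e + k) <= 1).
(** The sum of [delta ^+ n] over [n >= 1], used through its equation [delta * (1 + K) = K]. *)
Let K := delta / (1 - delta).
Let th := e + k.

Let d0 : 0 < delta. Proof. by case/andP: hd. Qed.
Let d1 : delta < 1. Proof. by case/andP: hd. Qed.
Let K0 : 0 < K. Proof. by rewrite divr_gt0 // subr_gt0. Qed.
Let KE : delta * (1 + K) = K. Proof. by rewrite /K; field; rewrite subr_eq0 gt_eqF. Qed.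
Let th0 : 0 < th. Proof. by rewrite addr_gt0. Qed.

Variable p : history R -> R.
Hypothesis hp : decision_rule p.
Let B := zero_discount delta p.

(** One Bellman step in which only the continuations after 0 and [z] are tracked; every other draw
    is charged the full [z], at total cost [k * z]. *)
Lemma Utrunc_step N g (a b c u : R) : 0 <= a -> 0 <= b -> best g = c ->
  (Utrunc delta p F N (rcons g 0%R) <= a%:E)%E ->
  (Utrunc delta p F N (rcons g z) <= b%:E)%E ->
  (forall x, 0 <= x <= z -> (Utrunc delta p F N (rcons g x) <= z%:E)%E) ->
  p g * c + (1 - p g) * delta * (a + e * b + k * z) <= u ->
  (Utrunc delta p F N.+1 g <= u%:E)%E.
Proof.
move=> a0 b0 gc ha hb hz hu; have /andP[p0 p1] := hp g.
rewrite -lee_fin in hu; apply: le_trans hu; rewrite EFinD; cbn [Utrunc].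
rewrite gc leeD2l // [leRHS]EFinM lee_wpmul2l ?lee_fin ?mulr_ge0 ?subr_ge0 ?(ltW d0) //.
by apply: (@integral_le_jackpot _ F) => //; rewrite ltW.
Qed.

(** The constant [z] is a supersolution: the crude integral bound gives [z * (1 + e + k)], which
    [small] absorbs. *)
Lemma Utrunc_le_jackpot N g : best g <= z -> (Utrunc delta p F N g <= z%:E)%E.
Proof.
elim: N g => [|N IH] g gz; have /andP[p0 p1] := hp g.
  by rewrite /= lee_fin; have := best_ge0 g; nra.
have hx x : 0 <= x <= z -> best (rcons g x) <= z.
  by move=> /andP[x0 xz]; rewrite best_rcons ge_max gz.
apply: (@Utrunc_step N g z z (best g)); rewrite ?(ltW z0) //.
- by apply/IH/hx; rewrite lexx ltW.
- by apply/IH/hx; rewrite lexx ltW.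
- by move=> x xz; apply/IH/hx.
have -> : (1 - p g) * delta * (z + e * z + k * z) =
          (1 - p g) * z * (delta * (1 + e + k)) by ring.
have h1 : 0 <= (1 - p g) * z by rewrite mulr_ge0 ?subr_ge0 // ltW.
by have := ler_wpM2l h1 small; have := ler_wpM2l p0 gz; lra.
Qed.

(** With [z] in hand and zeros following, the rule earns [z] times its zero-discount. Nonzero draws
    add at most [th * z] per round, in total [z * th * K]. The index is [N.+1] because truncation 0
    allows stopping in [Utrunc] but gives 0 in [zero_discount]. *)
Lemma Utrunc_after_jackpot N g : best g = z ->
  (Utrunc delta p F N g <= (z * (B N.+1 g + th * K))%R%:E)%E.
Proof.
have tK : 0 <= th * K by rewrite ltW // mulr_gt0.
elim: N g => [|N IH] g gz; have /andP[p0 p1] := hp g.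
  rewrite /B /= gz lee_fin mulr0 addr0.
  by have := mulr_ge0 (ltW z0) tK; lra.
have /andP[B0 B1] := zero_discount_itv N.+1 (rcons g 0%R) hd hp.
have hx x : 0 <= x <= z -> best (rcons g x) = z.
  by move=> /andP[x0 xz]; rewrite best_rcons gz; apply/max_idPl.
apply: (@Utrunc_step N g (z * (B N.+1 (rcons g 0%R) + th * K)) z z) => //.
- exact: mulr_ge0 (ltW z0) (addr_ge0 B0 tK).
- exact: (ltW z0).
- by apply/IH/hx; rewrite lexx ltW.
- by apply: Utrunc_le_jackpot; rewrite hx // lexx ltW.
- by move=> x xz; apply: Utrunc_le_jackpot; rewrite hx.
rewrite [B N.+2 g]/(p g + (1 - p g) * delta * B N.+1 (rcons g 0%R)).
set b := B _ _; rewrite -subr_ge0.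
have -> : z * (p g + (1 - p g) * delta * b + th * K) -
   (p g * z + (1 - p g) * delta * (z * (b + th * K) + e * z + k * z)) =
   z * th * (K - (1 - p g) * (delta * (1 + K))) by rewrite /th; ring.
rewrite KE (_ : K - (1 - p g) * K = p g * K); last by ring.
exact: mulr_ge0 (mulr_ge0 (ltW z0) (ltW th0)) (mulr_ge0 p0 (ltW K0)).
Qed.

(** If only zeros come and the rule stops at round T, the discounted number of draws is [delta + ...
    + delta ^+ T = K * (1 - delta ^+ T)]. Hence [K * (1 - B M g)] bounds its expectation, and each
    draw hits the jackpot with probability [e]. *)
Lemma Utrunc_before_jackpot h beta N M m : best h <= z -> 0 <= beta ->
  (forall n m, B n (rcons (h ++ nseq m 0) z) <= beta) ->
  let g := h ++ nseq m 0 in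
  (Utrunc delta p F N g <=
   (best h + k * z * K + e * z * (beta + th * K) * (K * (1 - B M g)))%R%:E)%E.
Proof.
move=> hz beta0 hbeta /=.
have tK : 0 <= th * K by rewrite ltW // mulr_gt0.
have bg i : best (h ++ nseq i 0%R) = best h.
  elim: i => [|i IH]; first by rewrite cats0.
  by rewrite -rcons_cat_nseq best_rcons IH; apply/max_idPl/best_ge0.
have y0 := best_ge0 h.
have E0 : 0 <= e * z * (beta + th * K).
  exact: mulr_ge0 (mulr_ge0 (ltW e0) (ltW z0)) (addr_ge0 beta0 tK).
have kz0 : 0 <= k * z by rewrite mulr_ge0 ?(ltW z0) ?(ltW k0).
(* The recursion of [B] unfolds only at a successor; the bound for [M = 0] is weaker than that for
   [M = 1], since [B] is 0 there. *)
suff key n i : (Utrunc delta p F N (h ++ nseq i 0%R) <=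
   (best h + k * z * K + e * z * (beta + th * K) *
    (K * (1 - B n.+1 (h ++ nseq i 0%R))))%R%:E)%E.
  case: M => [|M]; last exact: key.
  apply: le_trans (key 0 m) _; rewrite lee_fin lerD2l ler_wpM2l //.
  rewrite ler_wpM2l ?(ltW K0) // lerD2l lerN2.
  by have /andP[] := zero_discount_itv 1 (h ++ nseq m 0) hd hp.
elim: N n i => [|N IH] n i.
  rewrite /= bg lee_fin; have /andP[p0 p1] := hp (h ++ nseq i 0%R).
  have /andP[B0 B1] := zero_discount_itv n.+1 (h ++ nseq i 0%R) hd hp.
  apply: (@le_trans _ _ (best h + 0 + 0)); first by nra.
  rewrite !lerD // ?(mulr_ge0 kz0 (ltW K0)) //; apply: mulr_ge0 => //.
  by rewrite mulr_ge0 ?subr_ge0 // ltW.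
set g := h ++ nseq i 0%R; have /andP[p0 p1] := hp g.
have {}IH : (Utrunc delta p F N (rcons g 0%R) <=
   (best h + k * z * K + e * z * (beta + th * K) *
    (K * (1 - B n (rcons g 0%R))))%R%:E)%E.
  rewrite /g rcons_cat_nseq; case: n => [|n]; last exact: IH.
  apply: le_trans (IH 0 _) _; rewrite lee_fin lerD2l ler_wpM2l //.
  rewrite ler_wpM2l ?(ltW K0) // lerD2l lerN2.
  by have /andP[] := zero_discount_itv 1 (h ++ nseq i.+1 0) hd hp.
have /andP[B0 B1] := zero_discount_itv n (rcons g 0%R) hd hp.
have hx x : 0 <= x <= z -> best (rcons g x) <= z.
  by move=> /andP[x0 xz]; rewrite best_rcons bg ge_max hz.
apply: (@Utrunc_step N g _ (z * (beta + th * K)) (best h) _ _ _ (bg i) IH) => //.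
- rewrite addr_ge0 // ?addr_ge0 ?(mulr_ge0 kz0 (ltW K0)) //.
  by apply: mulr_ge0 => //; rewrite mulr_ge0 ?subr_ge0 // ltW.
- exact: mulr_ge0 (ltW z0) (addr_ge0 beta0 tK).
- apply: le_trans (Utrunc_after_jackpot _ _) _.
    by rewrite best_rcons bg; apply/max_idPr.
  by rewrite lee_fin ler_wpM2l ?(ltW z0) // lerD2r; exact: hbeta.
- by move=> x xz; apply/Utrunc_le_jackpot/hx.
rewrite [B n.+1 g]/(p g + (1 - p g) * delta * B n (rcons g 0%R)).
set b := B _ _; set y := best h; set E := beta + th * K; rewrite -subr_ge0.
(* The jackpot term balances exactly by the equation of [K]; the remaining slack is nonnegative. *)
have -> : y + k * z * K + e * z * E * (K * (1 - (p g + (1 - p g) * delta * b))) -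
  (p g * y + (1 - p g) * delta * (y + k * z * K + e * z * E * (K * (1 - b)) +
   e * (z * E) + k * z)) =
  (1 - p g) * (1 - delta) * y + k * z * (K - (1 - p g) * (delta * (1 + K)))
  + (1 - p g) * e * z * E * (K - delta * (1 + K)) by ring.
rewrite KE subrr mulr0 addr0 (_ : K - (1 - p g) * K = p g * K); last by ring.
have h1 : 0 <= (1 - p g) * (1 - delta) by rewrite mulr_ge0 ?subr_ge0 // ltW.
exact: addr_ge0 (mulr_ge0 h1 y0) (mulr_ge0 kz0 (mulr_ge0 p0 (ltW K0))).
Qed.

End Jackpot.

(** * Lower bound on the value: waiting for the jackpot *)

Lemma U_wait_for_jackpot (R : realType) (delta : R) (F : probability R R)
    (z e k : R) h :
  0 < delta < 1 -> jackpot F z e k -> 0 < z -> 0 < e -> 0 < k -> e + k < 1 ->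
  best h < z ->
  exists2 p, decision_rule p &
    ((delta * e * z / (1 - delta * (1 - (e + k))))%R%:E <= U delta p F h)%E.
Proof.
move=> hd jF z0 e0 k0 ek1 hz; have /andP[d0 d1] := hd.
pose p (g : history R) : R := if z <= best g then 1 else 0.
have hp : decision_rule p.
  by move=> g; rewrite /p; case: ifP => _; rewrite ?lexx ?ler01.
(* [w] solves [w = l * w + delta * e * z]: a zero keeps [w], the jackpot pays [z], and any other
   draw is counted as worthless. *)
exists p => //; set l := delta * (1 - (e + k)); set w := _ / _.
have l0 : 0 < l by rewrite mulr_gt0 // subr_gt0.
have l1 : l < 1 by rewrite /l; nra.
have w0 : 0 <= w by rewrite divr_ge0 ?subr_ge0 ?(ltW l1) // !mulr_ge0
    ?(ltW d0) ?(ltW e0) ?(ltW z0).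
have wE : w * (1 - l) = delta * e * z by rewrite /w divfK // subr_eq0 gt_eqF.
have hl : 0 < l < 1 by rewrite l0 l1.
have stopped N g : z <= best g -> (z%:E <= Utrunc delta p F N g)%E.
  move=> zg; case: N => [|N] /=; rewrite {1}/p zg mul1r ?lee_fin //.
  by rewrite /p zg subrr mul0r mul0e adde0 lee_fin.
apply: (lee_of_geometric_error (k := w) hl) => N.
apply: le_trans (ereal_sup_ubound _); last by exists N.
elim: N h hz => [|N IH] g gz.
  rewrite expr0 mul1r subrr; apply: Utrunc_ge0 => //; exact: ltW.
have pg : p g = 0 by rewrite /p leNgt gz.
cbn [Utrunc]; rewrite pg mul0r add0e subr0 mul1r.
have I : (((1 - e - k) * (w - l ^+ N * w) + e * z)%R%:E <=
          \int[F]_x Utrunc delta p F N (rcons g x))%E.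
  apply: (jackpot_le_integral jF z0) => //.
  - by rewrite subr_ge0 ler_piMl // exprn_ile1 // ltW.
  - exact: ltW.
  - by move=> x; apply: Utrunc_ge0 => //; exact: ltW.
  - by apply: IH; rewrite best_rcons gt_max gz z0.
  - by apply: stopped; rewrite best_rcons le_max lexx orbT.
apply: (@le_trans _ _ (delta%:E * ((1 - e - k) * (w - l ^+ N * w) + e * z)%R%:E)%E).
  rewrite -EFinM lee_fin exprS le_eqVlt; apply/orP; left; apply/eqP.
  have -> : delta * ((1 - e - k) * (w - l ^+ N * w) + e * z) =
     l * (w - l ^+ N * w) + delta * e * z by rewrite /l; ring.
  by rewrite -wE; ring.
by rewrite lee_wpmul2l // lee_fin ltW.
Qed.

Lemma le_best (R : realType) (h : history R) x : x \in h -> x <= best h.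
Proof.
rewrite /best; elim: h => // a h IH; rewrite in_cons big_cons le_max.
by move=> /orP[/eqP ->|/IH ->]; rewrite ?lexx ?orbT.
Qed.

Lemma histories_rcons (R : realType) (X : set R) (x0 : R) h x :
  histories X x0 h -> X x -> histories X x0 (rcons h x).
Proof.
move=> [xs [-> hX]] Xx; exists (rcons xs x); split=> // y.
by rewrite mem_rcons in_cons => /orP[/eqP ->|/hX].
Qed.

Lemma histories_cat_nseq (R : realType) (X : set R) (x0 : R) h m :
  X 0 -> histories X x0 h -> histories X x0 (h ++ nseq m 0).
Proof.
move=> X0 hh; elim: m => [|m IH]; first by rewrite cats0.
by rewrite -rcons_cat_nseq; exact: histories_rcons.
Qed.

(** * Escalating jackpots contradict a ratio above 1/4 *)

Section Escalation.
Context {R : realType} (delta : R) (X : set R) (x0 : R).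
Hypotheses (hd : 0 < delta < 1) (mX : measurable X).
Hypotheses (X_ge0 : X `<=` [set x | 0 <= x]) (X0 : X 0) (x00 : 0 < x0).
Hypothesis X_unbounded : forall M : R, exists x, X x /\ M < x.

Variables (p : history R -> R) (r : R).
Hypotheses (hp : decision_rule p) (r14 : (1 / 4 : R) < r).
Hypothesis p_ratio : forall h F p', histories X x0 h -> environment X F ->
  consistent F h -> decision_rule p' ->
  (r%:E * U delta p' F h <= U delta p F h)%E.

(* A jackpot worth much more than [best h] makes the ratio at [h] at most about
   [(1 - b) b'], where [b] and [b'] are the zero-discounts at [h] and after the
   jackpot; [(1 - b) b' >= r > 1/4 >= (1 - b) b] forces [b'] above [b]. *)
Lemma zero_discount_escalates h M : histories X x0 h ->
  exists h' M', histories X x0 h' /\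
    zero_discount delta p M h + (r - 1 / 4) / 2 <= zero_discount delta p M' h'.
Proof.
have r4 := r14; move=> hh; have /andP[d0 d1] := hd; set g := (r - 1 / 4) / 2.
have g0 : 0 < g by rewrite divr_gt0 // subr_gt0.
have r0 : 0 < r by lra.
set b := zero_discount delta p M h.
have /andP[b0 b1] : 0 <= b <= 1 by exact: zero_discount_itv.
have beta0 : 0 <= b + g by lra.
(* Otherwise [b + g] bounds the zero-discount at every history, in particular after the jackpot. *)
apply: contrapT => noh.
have {}noh h' M' : histories X x0 h' -> zero_discount delta p M' h' <= b + g.
  move=> hh'; rewrite leNgt; apply/negP => lt; apply: noh.
  by exists h', M'; split=> //; exact: ltW.
set K := delta / (1 - delta).
have K0 : 0 < K by rewrite divr_gt0 // subr_gt0.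
have KE : K * (1 - delta) = delta by rewrite /K divfK // subr_eq0 gt_eqF.
have KdE : delta / (1 - delta) = K by [].
clearbody K.
(* The final error is at most [e + 2 * e * K * (1 + r) = e * c / 2], so [e * c <= g] keeps it within
   [g / 2]. *)
pose c := 2 * (1 + 2 * K * (1 + r)).
have c0 : 2 < c.
  have : 0 < K * (1 + r) by rewrite mulr_gt0 //; lra.
  by rewrite /c; nra.
pose e := Num.min ((1 - delta) / 2) (g / c).
have e0 : 0 < e by rewrite lt_min !divr_gt0 //; lra.
have e1 : e <= (1 - delta) / 2 by rewrite ge_min lexx.
have e2 : e * c <= g by rewrite -ler_pdivlMr ?ge_min ?lexx ?orbT //; lra.
clearbody e.
have ee : e * e <= e by rewrite ler_piMl //; lra.
(* The mass [k] is taken to be [e * e], so its contribution is [e] times the leading term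
   [K * e * z]. *)
have ee0 : 0 < e * e by rewrite mulr_gt0.
have y0 : 0 < best h by exact: best_histories_gt0 hh.
set y := best h in y0.
have Keg : 0 < K * e * g := mulr_gt0 (mulr_gt0 K0 e0) g0.
(* [z] is so large that [y] is less than the fraction [g / 2] of [K * e * z]. *)
have [z [Xz zlt]] := X_unbounded (y + 2 * y / (K * e * g)).
have yz : y < z.
  by apply: le_lt_trans zlt; rewrite lerDl divr_ge0 ?(ltW Keg) // mulr_ge0 // ltW.
have z0 : 0 < z by lra.
have zbig : 2 * y < z * (K * e * g).
  rewrite -ltr_pdivrMr //; apply: le_lt_trans zlt; rewrite lerDr; exact: ltW.
have ek1 : e + e * e < 1 by lra.
have small : delta * (1 + e + e * e) <= 1.
  have : delta * (1 + e + e * e) <= delta * (1 + (1 - delta)).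
    by rewrite ler_wpM2l ?(ltW d0) //; lra.
  by nra.
have hs x : x \in behead h -> X x /\ 0 <= x < z.
  move: hh => [xs [hE hX]]; rewrite hE /= => xxs; split; first exact: hX.
  apply/andP; split; first exact/X_ge0/hX.
  by apply: le_lt_trans yz; rewrite /y hE le_best // in_cons xxs orbT.
have [F [jF envF Fs]] := jackpot_exists mX X0 Xz hs z0 (ltW e0) ee0 ek1.
have consF : consistent F h.
  rewrite /consistent /likelihood big_seq.
  apply: (big_ind (fun x : R => 0 < x)) => [||x xs].
  - exact: ltr01.
  - by move=> u v; exact: mulr_gt0.
  rewrite fine_gt0 // Fs //= ltey_eq fin_num_measure //; exact: measurable_set1.
have [q hq Vq] := U_wait_for_jackpot hd jF z0 e0 ee0 ek1 yz.
have Up : (U delta p F h <= (y + e * e * z * K +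
   e * z * (b + g + (e + e * e) * K) * (K * (1 - b)))%R%:E)%E.
  apply: ge_ereal_sup => _ [N _ <-].
  have := @Utrunc_before_jackpot _ delta F z e (e * e) hd jF z0 e0 ee0 small p hp
    h (b + g) N M 0 (ltW yz) beta0.
  rewrite cats0 KdE.
  apply=> n m; apply: noh; apply: histories_rcons => //.
  exact: histories_cat_nseq.
have := le_trans (lee_wpmul2l _ Vq) (le_trans (p_ratio hh envF consF hq) Up).
rewrite lee_fin => /(_ (ltW r0)); set w := _ / _.
set th := e + e * e in jF ek1 w Up *; rewrite -EFinM lee_fin => main.
set D := K * e * z.
have D0 : 0 < D := mulr_gt0 (mulr_gt0 K0 e0) z0.
have K1 : 0 < 1 + K * th by rewrite addr_gt0 // mulr_gt0 // addr_gt0.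
have wE : w * (1 + K * th) = D.
  rewrite /w /D; have -> : 1 - delta * (1 - th) = (1 - delta) * (1 + K * th).
    rewrite (_ : (1 - delta) * (1 + K * th) = 1 - delta + K * (1 - delta) * th).
      by rewrite KE; ring.
    by ring.
  rewrite invfM mulrA divfK ?gt_eqF // mulrAC [delta * e / _]mulrAC.
  by rewrite KdE.
(* [D] is the leading term of the waiting value: [w = D / (1 + K * th) >= D * (1 - K * th)]. *)
have wD : D * (1 - K * th) <= w.
  rewrite -wE -mulrA ler_piMr //.
    by rewrite -(pmulr_lge0 _ K1) wE ltW.
  by rewrite mulrDl mul1r; nra.
have E : y + e * e * z * K + e * z * (b + g + th * K) * (K * (1 - b)) =
  y + D * (e + (b + g + th * K) * (1 - b)) by rewrite /D; ring.
rewrite E in main.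
have h1 : y < D * (g / 2) by rewrite /D; lra.
have h2 : (b + g + th * K) * (1 - b) <= r - g + th * K.
  (* The constant 1/4 enters here; by the choice of [g], [1 / 4 + g = r - g]. *)
  have q1 : b * (1 - b) <= 1 / 4 by have := sqr_ge0 (b - 1 / 2); rewrite expr2; lra.
  have q2 : (g + th * K) * (1 - b) <= g + th * K.
    have tK : 0 < th * K := mulr_gt0 (addr_gt0 e0 ee0) K0.
    by rewrite ler_piMr //; lra.
  by rewrite /g in q2 *; lra.
have h3 : r * (D * (1 - K * th)) <= r * w by rewrite ler_wpM2l // ltW.
have h4 : D * (e + (b + g + th * K) * (1 - b)) <= D * (e + (r - g + th * K)).
  by rewrite ler_wpM2l ?(ltW D0) // lerD2l.
have h5 : D * (r * (1 - K * th)) < D * (g / 2 + (e + (r - g + th * K))) by lra.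
rewrite ltr_pM2l // in h5.
have h6 : th * (K * (1 + r)) <= 2 * e * (K * (1 + r)).
  rewrite ler_wpM2r //; first by rewrite mulr_ge0 ?(ltW K0) //; lra.
  by rewrite /th; lra.
by rewrite /c in e2; lra.
Qed.

(** Each escalation gains the fixed amount [g], so more than [1 / g] of them push a zero-discount
    above 1. *)
Lemma ratio_contradiction : False.
Proof.
set g := (r - 1 / 4) / 2; have g0 : 0 < g by rewrite divr_gt0 // subr_gt0.
have H n : exists h M, histories X x0 h /\ n%:R * g <= zero_discount delta p M h.
  elim: n => [|n [h [M [hh hM]]]].
    by exists [:: x0], 0; rewrite mul0r lexx; split=> //; exists [::].
  have [h' [M' [hh' hM']]] := zero_discount_escalates M hh.
  exists h', M'; split=> //; apply: le_trans hM'.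
  by rewrite -natr1 mulrDl mul1r lerD2r.
have [h [M [_ hM]]] := H (Num.truncn g^-1).+1.
have /andP[_ le1] := zero_discount_itv M h hd hp.
have : g^-1 < (Num.truncn g^-1).+1%:R by exact: truncnS_gt.
by rewrite -(ltr_pM2r g0) mulVf ?gt_eqF // ltNge (le_trans hM).
Qed.

End Escalation.

(** * The upper bound 1/4 for every rule, and the conclusion *)

Lemma perf_ratio_le (R : realType) (delta : R) (X : set R) (x0 : R) p :
  0 < delta < 1 -> measurable X -> X `<=` [set x | 0 <= x] -> X 0 -> 0 < x0 ->
  (forall M : R, exists x, X x /\ M < x) -> decision_rule p ->
  (perf_ratio delta X x0 p <= (1 / 4)%R%:E)%E.
Proof.
move=> hd mX Xge0 X0 x00 Xub hp; rewrite leNgt; apply/negP => lt14.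
have [r r14 hr] : exists2 r, 1 / 4 < r & (r%:E <= perf_ratio delta X x0 p)%E.
  case: (perf_ratio delta X x0 p) lt14 => [r| |] //; rewrite ?lte_fin.
    by exists r.
  by exists 1; rewrite ?leey //; lra.
apply: (ratio_contradiction hd mX Xge0 X0 x00 Xub hp r14) => h F p' hh envF cF hp'.
(* A prior concentrated on [F] turns the performance ratio into the bound for a single
   environment. *)
pose mu : prior R := [:: (1, F)].
have hmu : consistent_prior X h mu.
  split; last by rewrite big_seq1.
  by move=> wF; rewrite mem_seq1 => /eqP ->; rewrite ltr01.
have UE q : Uprior delta q mu h = U delta q F h.
  rewrite /Uprior big_seq1 /posterior big_seq1 /= mul1r divff ?mul1e //.
  by rewrite gt_eqF.
have [u u0 [_ uV Vu]] := prior_bounds hd x00 hh hmu.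
have Up' : (U delta p' F h <= Vprior delta mu h)%E.
  by rewrite -UE; apply: ereal_sup_ubound; exists p'.
have : (r%:E <= Uprior delta p mu h / Vprior delta mu h)%E.
  by apply: le_trans hr _; apply: ereal_inf_lbound; exists h, mu.
rewrite UE; case: (Vprior delta mu h) uV Vu Up' => [v| |] //.
rewrite !lee_fin => uv _ Up'; have v0 : 0 < v by exact: lt_le_trans uv.
rewrite inver gt_eqF // => /(@lee_wpmul2r _ v%:E).
rewrite lee_fin (ltW v0) -muleA -[(_^-1%:E * _)%E]EFinM mulVf ?gt_eqF // mule1 => /(_ isT).
by apply: le_trans; rewrite lee_wpmul2l // lee_fin; lra.
Qed.

Theorem theorem2 (R : realType) (delta : R) (X : set R) (x0 : R) :
  0 < delta < 1 ->
  measurable X ->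
  X `<=` [set x | 0 <= x] ->
  X 0 ->
  0 < x0 ->
  let pbar := fun _ : history R => (1 - delta) / (2 - delta) in
  ((1 / 4)%:E <= perf_ratio delta X x0 pbar)%E /\
  ((forall M : R, exists x, X x /\ M < x) ->
     dynamically_robust delta X x0 pbar).
Proof.
move=> hd mX Xge0 X0 x00 pbar.
have lb : ((1 / 4)%R%:E <= perf_ratio delta X x0 pbar)%E.
  exact: perf_ratio_pbar_ge.
split=> // Xub; apply/eqP; rewrite eq_le; apply/andP; split.
  by apply: ereal_sup_ubound; exists pbar => //; exact: decision_rule_pbar.
apply: ge_ereal_sup => _ [p hp <-]; apply: le_trans lb.
exact: perf_ratio_le.
Qed.
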